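(* Let $V$ be a finite set with $n$ elements and let $\mathsf{ALG}$ be any deterministic algorithm for submodular function minimization (SFM) on the ground set $V$. Then there exists a submodular function $F : 2^V \to \mathbb{R}$ such that $\mathsf{ALG}$ makes at least $\frac{n}{2}\log_2\left(\frac{n}{4}\right)$ evaluation oracle queries to minimize $F$.
   Context: A function $f: 2^V \to \mathbb{R}$ on subsets of a finite set $V$ is submodular if $f(X)+f(Y) \ge f(X\cup Y) + f(X \cap Y)$ for all $X, Y \subseteq V$. SFM problem: given black-box access to a submodular $f:2^V\to\mathbb{R}$ through an evaluation oracle, which returns the value $f(S)$ when queried with a set $S\subseteq V$, find a set $S \subseteq V$ minimizing $f$. The ground set $V$ is known to the algorithm. A deterministic SFM algorithm adaptively chooses query sets, each a deterministic function of the answers to the previous queries, and after finitely many queries outputs a set; it is required that for every submodular $f:2^V\to\mathbb{R}$ the output set is a minimizer of $f$. Only the number of oracle queries is counted (computation between queries is unrestricted). The number of queries made to minimize $F$ is the number of queries made when the algorithm is run with the evaluation oracle of $F$ until it outputs a minimizer. *)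

(* Defs.v *)
From HB Require Import structures.
From mathcomp Require Import all_boot all_order all_algebra.
From mathcomp Require Import reals exp.

Set Implicit Arguments.
Unset Strict Implicit.
Unset Printing Implicit Defensive.

Import Order.TTheory GRing.Theory Num.Theory.
Local Open Scope ring_scope.

Definition submodular (R : realType) (V : finType) (f : {set V} -> R) : Prop :=
  forall X Y : {set V}, f (X :|: Y) + f (X :&: Y) <= f X + f Y.

Definition minimizer (R : realType) (V : finType) (f : {set V} -> R)
    (S : {set V}) : Prop :=
  forall T : {set V}, f S <= f T.

Inductive action (V : finType) : Type :=
| Query of {set V}
| Output of {set V}.

(* The argument lists the oracle's answers so far, oldest first.  Since the
   algorithm is deterministic, these answers determine the past queries.
   No termination is imposed on answer sequences that come from no submodular
   function. *)
Definition algorithm (R : realType) (V : finType) : Type := seq R -> action V.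

(* [runs A f h q S]: from the answer history [h], with oracle [f], [A] makes
   exactly [q] further queries (repetitions counted) and then outputs [S]. *)
Inductive runs (R : realType) (V : finType) (A : algorithm R V)
    (f : {set V} -> R) : seq R -> nat -> {set V} -> Prop :=
| runs_output h S : A h = Output S -> runs A f h 0 S
| runs_query h X q S :
    A h = Query X -> runs A f (rcons h (f X)) q S -> runs A f h q.+1 S.

Definition solves_SFM (R : realType) (V : finType) (A : algorithm R V) : Prop :=
  forall f : {set V} -> R, submodular f ->
    exists (q : nat) (S : {set V}), runs A f [::] q S /\ minimizer f S.

(* [ln] is total with [ln 0 = 0]. *)
Definition log2 (R : realType) (x : R) : R := ln x / ln 2.

(* Main.v *)
(* Given pairs (a_1, b_1), ..., (a_k, b_k) of distinct elements, let F(S) be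
   determined by the first i such that not (a_i \in S and b_i \notin S): it is
   M |S| if S misses a_i and b_i, M (n - |S|) if S contains both, and M n if S
   contains b_i only; F(S) = -1 if there is no such i.  With M decreasing fast
   enough in i, F is submodular, and its minimizers contain all a_i and no b_i.
   A query failing at pair i says nothing about the later pairs.  The adversary
   keeps a set C of candidates for a_i and b_i and answers as if both were on the
   side of the query where C is larger; when C is down to two elements, it orients
   them so that one more query fails.  So with m elements left, a pair costs
   log2 m queries; summing over m = n, n - 2, ... gives n! <= 4 ^ q, and
   n ^ n <= 4 ^ n * n! since n ^ n / n! <= C(2n, n) <= 4 ^ n. *)
Require Import Defs.
From HB Require Import structures.
From mathcomp Require Import all_boot all_order all_algebra.
From mathcomp Require Import reals exp.
From mathcomp Require Import zify ring lra.

Set Implicit Arguments.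
Unset Strict Implicit.
Unset Printing Implicit Defensive.

Import Order.TTheory GRing.Theory Num.Theory.
Local Open Scope ring_scope.

(** * Factorial estimates and counting *)

Lemma fact_le_sqr_mul (m : nat) : (m.+2`! <= m.+2 ^ 2 * m`!)%N.
Proof. by rewrite !factS; nia. Qed.

Lemma expnn_le_fact (n : nat) : (n ^ n <= 4 ^ n * n`!)%N.
Proof.
have ffact_ge k : (k <= n -> n ^ k <= (n + n) ^_ k)%N.
  elim: k => [|k IHk] lekn; first by rewrite expn0 ffactn0.
  rewrite expnSr ffactnSr leq_mul ?IHk ?(ltnW lekn) //; lia.
apply: leq_trans (ffact_ge n (leqnn n)) _.
rewrite -bin_ffact leq_mul2r; apply/orP; right.
(* The central binomial coefficient is one term of the expansion of [(1 + 1) ^ (n + n)]. *)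
rewrite -[4%N]/(2 ^ 2)%N -expnM mul2n -addnn -[2%N]/(1 + 1)%N expnDn.
have ltn : (n < (n + n).+1)%N by lia.
by rewrite (bigD1 (Ordinal ltn)) //= !exp1n !muln1 leq_addr.
Qed.

Lemma cardsD2 (V : finType) (W : {set V}) (a b : V) :
  a \in W -> b \in W -> a != b -> #|W :\ a :\ b| = (#|W| - 2)%N.
Proof.
move=> aW bW ab; have := cardsD1 a W; have := cardsD1 b (W :\ a).
by rewrite aW !inE eq_sym ab bW /=; lia.
Qed.

(** Pigeonhole on the two sides of [X]. The bounds are strict so that two elements remain at
    [t = 0]. *)
Lemma half_in (V : finType) (X C : {set V}) (t : nat) : (2 ^ t.+1 < #|C|)%N ->
  exists2 D : {set V}, D \subset C &
    (2 ^ t < #|D|)%N /\ (D \subset X \/ [disjoint D & X]).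
Proof.
rewrite expnS => ltC; have := cardsID X C.
case: (ltnP (2 ^ t) #|C :&: X|) => [lt _ | le eqC].
  by exists (C :&: X); rewrite ?subsetIl //; split=> //; left; rewrite subsetIr.
exists (C :\: X); rewrite ?subsetDl //; split; first by lia.
by right; rewrite -setI_eq0 setIDAC setDIl setDv setI0.
Qed.

(** * The submodular functions with hidden pairs *)

Section HiddenPairs.
Variables (R : realType) (V : finType).
Implicit Types (ps qs : seq (V * V)) (S T W X Y C : {set V}) (a b : V).

(* Twice the bound on the values of [hidden] for [k] pairs (see [hidden_bound]),
   so that it dominates the marginals of that function. *)
Definition penalty (k : nat) : R := 2 * (2 * #|V|%:R) ^+ k.

Fixpoint hidden ps S : R :=
  if ps is (a, b) :: ps' then
    let M := penalty (size ps') in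
    if a \in S then
      if b \in S then M * (#|V|%:R - #|S|%:R) else hidden ps' S
    else if b \in S then M * #|V|%:R else M * #|S|%:R
  else -1.

Lemma penalty_ge0 k : 0 <= penalty k.
Proof. by rewrite /penalty mulr_ge0 ?exprn_ge0 ?mulr_ge0. Qed.

Lemma cardsV_le S : #|S|%:R <= #|V|%:R :> R.
Proof. by rewrite ler_nat max_card. Qed.

Lemma penalty_card k : penalty k * #|V|%:R = (2 * #|V|%:R) ^+ k.+1.
Proof. by rewrite exprSr /penalty; ring. Qed.

Lemma hidden_bound ps S : `|hidden ps S| <= (2 * #|V|%:R) ^+ size ps.
Proof.
elim: ps => [|[a b] ps IHps] /=; first by rewrite normrN1 expr0.
have M0 := penalty_ge0 (size ps); have SV := cardsV_le S.
have S0 : 0 <= #|S|%:R :> R by [].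
rewrite -penalty_card.
case: ifP => aS; case: ifP => bS.
- by rewrite ger0_norm; nra.
- apply: le_trans IHps _; rewrite penalty_card exprS ler_peMl ?exprn_ge0 //.
    by rewrite mulr_ge0.
  have : 1 <= #|V|%:R :> R by rewrite ler1n; apply/card_gt0P; exists a.
  by lra.
- by rewrite ger0_norm; nra.
- by rewrite ger0_norm; nra.
Qed.

Lemma hidden_submodular ps : submodular (hidden ps).
Proof.
elim: ps => [|[a b] ps IHps] X Y /=; first by rewrite lexx.
have M0 := penalty_ge0 (size ps).
have bound S : - penalty (size ps) <= 2 * hidden ps S <= penalty (size ps).
  by have := hidden_bound ps S; rewrite /penalty ler_norml; lra.
set M := penalty _ in M0 bound *; pose m S := M * #|S|%:R.
have UI : m (X :|: Y) + m (X :&: Y) = m X + m Y.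
  by rewrite -!mulrDr -!natrD cardsUI.
have IX : m (X :&: Y) <= m X.
  by rewrite ler_wpM2l // ler_nat subset_leq_card ?subsetIl.
have IY : m (X :&: Y) <= m Y.
  by rewrite ler_wpM2l // ler_nat subset_leq_card ?subsetIr.
(* If S is not inside T, the drop of at least [M] outweighs any difference of two values of
   [hidden ps], each at most M/2 in absolute value. If S is inside T, union and intersection are T
   and S themselves. *)
have cmp S T : (S :&: T = S /\ S :|: T = T) \/ m (S :&: T) + M <= m S.
  have [eqI | /proper_card lt] := eqVproper (subsetIl S T); [left | right].
    by split=> //; apply/setUidPr/setIidPl.
  by rewrite -[X in _ + X]mulr1 -mulrDr ler_wpM2l // natr1 ler_nat.
have cmpX := cmp X Y; have cmpY := cmp Y X.
rewrite setIC [Y :|: X]setUC in cmpY.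
rewrite !inE !mulrBr -!/(m _).
have := IHps X Y; have := bound X; have := bound Y.
have := bound (X :|: Y); have := bound (X :&: Y).
case aX: (a \in X); case bX: (b \in X); case aY: (a \in Y);
  case bY: (b \in Y) => /=; try lra.
- by case: cmpY => [[-> ->]|]; lra.
- by case: cmpX => [[-> ->]|]; lra.
- by case: cmpX => [[/setIidPl/subsetP/(_ a aX)]|]; [rewrite aY|lra].
- by case: cmpY => [[-> ->]|]; lra.
- by case: cmpY => [[/setIidPr/subsetP/(_ a aY)]|]; [rewrite aX|lra].
- by case: cmpX => [[-> ->]|]; lra.
Qed.

(* The clauses off the sublattice [a \in X, b \notin X] do not mention the later
   pairs, so a query there reveals nothing about them. *)
Lemma hidden_blind ps a b a' b' qs qs' X :
  size qs = size qs' -> (a \in X) = (a' \in X) -> (b \in X) = (b' \in X) ->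
  ~~ ((a \in X) && (b \notin X)) ->
  hidden (ps ++ (a, b) :: qs) X = hidden (ps ++ (a', b') :: qs') X.
Proof.
move=> eqsz aa bb; elim: ps => [|[c d] ps IHps] /=.
  by rewrite -aa -bb eqsz; case: (a \in X); case: (b \in X).
by move=> /IHps->; rewrite !size_cat /= eqsz.
Qed.

(** Every penalty clause is nonnegative, so a negative value can only be the final -1. *)
Lemma hidden_lt0 ps S :
  hidden ps S < 0 -> all (fun p => (p.1 \in S) && (p.2 \notin S)) ps.
Proof.
elim: ps => [|[a b] ps IHps] //=.
have M0 := penalty_ge0 (size ps); have SV := cardsV_le S.
by case: ifP => aS; case: ifP => bS //=; rewrite ltNge mulr_ge0 ?subr_ge0.
Qed.

Fixpoint disjoint_pairs W ps : bool :=
  if ps is (a, b) :: ps' then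
    [&& a \in W, b \in W, a != b & disjoint_pairs (W :\ a :\ b) ps']
  else true.

(** Add the first element of every pair to [T]. The bound [T :|: W] keeps out the second elements,
    which leave [W] with their pair. *)
Lemma hidden_attains ps W T : disjoint_pairs W ps -> [disjoint T & W] ->
  exists S, [/\ T \subset S, S \subset T :|: W & hidden ps S = -1].
Proof.
elim: ps W T => [|[a b] ps IHps] W T /=.
  by move=> _ _; exists T; rewrite subsetUl.
case/and4P=> aW bW ab disj /pred0P TW.
have dTW : [disjoint a |: T & W :\ a :\ b].
  apply/pred0P=> x; have /= := TW x; rewrite !inE.
  by case: eqP => //=; rewrite ?andbF // => _; case: (x \in T) => //= ->; rewrite !andbF.
have [S [TS SW FS]] := IHps _ _ disj dTW.
have aS : a \in S by apply: (subsetP TS); rewrite !inE eqxx.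
have bT : b \notin T by have /= := TW b; rewrite bW andbT => ->.
have bS : b \notin S.
  apply/negP=> /(subsetP SW); rewrite !inE eqxx (negPf bT) orbF eq_sym.
  by rewrite (negPf ab).
exists S; rewrite aS (negPf bS) FS; split=> //.
  by apply: subset_trans TS; rewrite subsetUr.
apply: subset_trans SW _; apply/subsetP=> x; rewrite !inE.
case/orP=> [/orP[/eqP->|->]|/and3P[_ _ ->]] //; rewrite ?aW ?orbT //.
Qed.

Lemma hidden_minimizer ps S :
  disjoint_pairs [set: V] ps -> minimizer (hidden ps) S ->
  all (fun p => (p.1 \in S) && (p.2 \notin S)) ps.
Proof.
move=> disj minS.
have [|T [_ _ FT]] := hidden_attains (T := set0) disj.
  by apply/pred0P=> x; rewrite /= inE.
by apply: hidden_lt0; apply: le_lt_trans (minS T) _; rewrite FT ltrN10.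
Qed.

Lemma disjoint_pairs_exist W (k : nat) : (k.*2 <= #|W|)%N ->
  exists2 ps, disjoint_pairs W ps & size ps = k.
Proof.
elim: k W => [|k IHk] W leW; first by exists [::].
have [a [b [aW bW ab]]] : exists a b, [/\ a \in W, b \in W & a != b].
  by apply/card_gt1P; lia.
have [|ps disj szps] := IHk (W :\ a :\ b).
  by rewrite cardsD2 //; lia.
by exists ((a, b) :: ps); rewrite /= ?aW ?bW ?ab ?szps.
Qed.

(** * The adversary argument *)

Section Adversary.
Variable A : algorithm R V.
Implicit Types (F : {set V} -> R) (h : seq R).

Definition solves_from F h (q : nat) : Prop :=
  exists2 S, runs A F h q S & minimizer F S.

Lemma solves_from_output F h q S :
  A h = Output S -> solves_from F h q -> minimizer F S.
Proof. by move=> Ah [T runT]; case: runT Ah => [{}h U -> | {}h X {}q U ->] // [->]. Qed.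

Lemma solves_from_query F h q X : A h = Query X -> solves_from F h q ->
  exists q', solves_from F (rcons h (F X)) q'.
Proof.
move=> Ah [T runT minT]; case: runT Ah minT => [{}h U -> | {}h Y {}q U ->] //.
by move=> runU [<-] minU; exists q, U.
Qed.

Lemma solves_from_step F h q X :
  A h = Query X -> solves_from F (rcons h (F X)) q -> solves_from F h q.+1.
Proof. by move=> Ah [T runT minT]; exists T => //; apply: runs_query Ah runT. Qed.

(** State of the game: [h] is the history, [ps] the pairs already fixed, [P] the continuations still
    open. *)
Definition solves_all ps h (P : seq (V * V) -> Prop) : Prop :=
  forall qs, P qs -> disjoint_pairs [set: V] (ps ++ qs) /\
    exists q, solves_from (hidden (ps ++ qs)) h q.

Definition completion W (k : nat) qs : Prop := disjoint_pairs W qs /\ size qs = k.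

Definition completion_in C W (k : nat) qs : Prop :=
  exists a b qs', [/\ qs = (a, b) :: qs', a \in C, b \in C & completion W k qs].

Lemma solves_all_answer ps h X (y : R) (P Q : seq (V * V) -> Prop) :
  A h = Query X -> (forall qs, Q qs -> P qs /\ hidden (ps ++ qs) X = y) ->
  solves_all ps h P -> solves_all ps (rcons h y) Q.
Proof.
move=> Ah QP solveP qs /QP[/solveP[disj [q solq]] <-]; split=> //.
exact: solves_from_query Ah solq.
Qed.

Lemma exists_completion_in C W (k : nat) a b :
  C \subset W -> (k.+1.*2 <= #|W|)%N -> a \in C -> b \in C -> a != b ->
  exists2 qs, completion_in C W k.+1 ((a, b) :: qs) & size qs = k.
Proof.
move=> /subsetP CW leW aC bC ab.
have [|qs disj szqs] := @disjoint_pairs_exist (W :\ a :\ b) k.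
  by have := cardsD2 (CW _ aC) (CW _ bC) ab; lia.
exists qs => //; exists a, b, qs; split=> //; split; last by rewrite /= szqs.
by rewrite /= !CW ?ab.
Qed.

(** An output now would have to minimize for both orientations of a pair from [C], hence both
    contain and omit the same element. *)
Lemma exists_query ps h C W (k : nat) :
  C \subset W -> (k.+1.*2 <= #|W|)%N -> (1 < #|C|)%N ->
  solves_all ps h (completion_in C W k.+1) -> exists X, A h = Query X.
Proof.
move=> CW leW /card_gt1P[a [b [aC bC ab]]] solve.
case Ah: (A h) => [X | S]; first by exists X.
have ba : b != a by rewrite eq_sym.
have [qs /solve[disj [q /(solves_from_output Ah) minS]] _] :=
  exists_completion_in CW leW aC bC ab.
have [qs' /solve[disj' [q' /(solves_from_output Ah) minS']] _] :=
  exists_completion_in CW leW bC aC ba.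
have := hidden_minimizer disj minS; have := hidden_minimizer disj' minS'.
by rewrite !all_cat /= => /and3P[_ /andP[_ /negPf->]] _ /and3P[_ /andP[]].
Qed.

(** Fixing one pair costs [t] halvings of [C] and one orienting query, each worth a factor 4; the
    first hypothesis bounds the later pairs. *)
Lemma adversary_phase (k t : nat) ps h C W :
  (forall ps h W, #|W|./2 = k -> solves_all ps h (completion W k) ->
    exists qs q, [/\ completion W k qs, solves_from (hidden (ps ++ qs)) h q
      & #|W|`! <= 4 ^ q])%N ->
  #|W|./2 = k.+1 -> C \subset W -> (2 ^ t < #|C|)%N ->
  solves_all ps h (completion_in C W k.+1) ->
  exists qs q, [/\ completion_in C W k.+1 qs, solves_from (hidden (ps ++ qs)) h q
    & (4 ^ t.+1 * (#|W| - 2)`! <= 4 ^ q)%N].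
Proof.
move=> IH halfW; have leW : (k.+1.*2 <= #|W|)%N by lia.
elim: t C h => [|t IHt] C h CW ltC solve.
  have [X Ah] := exists_query CW leW ltC solve.
  have [a [b [aC bC ab blind]]] : exists a b,
      [/\ a \in C, b \in C, a != b & ~~ ((a \in X) && (b \notin X))].
    have [a [b [aC bC ab]]] := card_gt1P ltC.
    have [bad|] := boolP ((a \in X) && (b \notin X)); last by exists a, b.
    exists b, a; rewrite eq_sym ab; split=> //.
    by case/andP: bad => ->; rewrite andbF.
  (* The later pairs do not affect the answer, so any [qs0] of the right length defines it. *)
  have [qs0 _ sz0] := exists_completion_in CW leW aC bC ab.
  pose y := hidden (ps ++ (a, b) :: qs0) X.
  have answer qs : size qs = k -> hidden (ps ++ (a, b) :: qs) X = y.
    by move=> szqs; apply: hidden_blind; rewrite ?szqs.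
  have eW := cardsD2 (subsetP CW _ aC) (subsetP CW _ bC) ab.
  have compl qs : completion (W :\ a :\ b) k qs ->
      completion_in C W k.+1 ((a, b) :: qs).
    case=> disj szqs; exists a, b, qs; split=> //; split; last by rewrite /= szqs.
    by rewrite /= !(subsetP CW) ?ab.
  have [||qs [q [cqs solq leq]]] := IH (rcons ps (a, b)) (rcons h y) (W :\ a :\ b).
  - by rewrite eW; lia.
  - move=> qs [disj szqs]; rewrite cat_rcons -(answer _ szqs).
    have [disj' [q solq]] := solve _ (compl _ (conj disj szqs)).
    by split=> //; apply: solves_from_query Ah solq.
  exists ((a, b) :: qs), q.+1; split; first exact: compl.
    by apply: solves_from_step Ah _; rewrite (answer _ cqs.2) -cat_rcons.
  by rewrite expn1 expnS leq_mul2l -eW leq.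
have C2 : (1 < #|C|)%N by apply: leq_ltn_trans ltC; rewrite expn_gt0.
have [X Ah] := exists_query CW leW C2 solve.
have [C' C'C [ltC' side]] := half_in X ltC.
have [a [b [aC' bC' ab]]] : exists a b, [/\ a \in C', b \in C' & a != b].
  by apply/card_gt1P; apply: leq_ltn_trans ltC'; rewrite expn_gt0.
have C'W := subset_trans C'C CW.
have [qs0 _ sz0] := exists_completion_in C'W leW aC' bC' ab.
pose y := hidden (ps ++ (a, b) :: qs0) X.
(* All of [C'] is on one side of [X], so no pair from [C'] passes and all of them give the same
   answer. *)
have side_eq c : c \in C' -> (a \in X) = (c \in X).
  move=> cC'; case: side => [/subsetP sub | dis]; first by rewrite !sub.
  by rewrite !(disjointFr dis).
have answer qs : completion_in C' W k.+1 qs ->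
    completion_in C W k.+1 qs /\ hidden (ps ++ qs) X = y.
  case=> [c [d [qs' [-> cC' dC' cqs]]]]; split.
    by exists c, d, qs'; rewrite !(subsetP C'C).
  apply: hidden_blind; rewrite -?(side_eq c) -?(side_eq d) -?(side_eq b) //.
    by case: cqs => _ [->].
  by case: (a \in X).
have [qs [q [cqs solq leq]]] :=
  IHt C' (rcons h y) C'W ltC' (solves_all_answer Ah answer solve).
have [cqs' answer_qs] := answer _ cqs.
exists qs, q.+1; split=> //; first by apply: solves_from_step Ah _; rewrite answer_qs.
by rewrite (expnS 4 t.+1) -mulnA (expnS 4 q) leq_mul2l leq.
Qed.

Lemma adversary (k : nat) ps h W :
  #|W|./2 = k -> solves_all ps h (completion W k) ->
  exists qs q, [/\ completion W k qs, solves_from (hidden (ps ++ qs)) h q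
    & (#|W|`! <= 4 ^ q)%N].
Proof.
elim: k ps h W => [|k IHk] ps h W halfW solve.
  have [//|_ [q solq]] := solve [::]; exists [::], q; split=> //.
  have : (#|W| <= 1)%N by lia.
  by case: #|W| => [|[]] //; rewrite expn_gt0.
(* With this [t], [4 ^ t.+1] is at least [#|W| ^ 2], which covers the two factors by which the
   factorials of |W| and |W| - 2 differ. *)
pose t := (up_log 2 #|W|).-1.
have W2 : (1 < #|W|)%N by lia.
have /andP[ltW leW] : (2 ^ t < #|W| <= 2 ^ t.+1)%N.
  by rewrite prednK ?up_log_gt0 //; apply: up_log_bounds.
have solve_in : solves_all ps h (completion_in W W k.+1).
  by move=> qs [a [b [qs' [_ _ _]]]]; apply: solve.
have [qs [q [[a [b [qs' [_ _ _ cqs]]]] solq leq]]] :=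
  adversary_phase IHk halfW (subxx W) ltW solve_in.
exists qs, q; split=> //; apply: leq_trans leq.
case eW: #|W| halfW leW => [|[|m]] // _ leW.
apply: leq_trans (fact_le_sqr_mul m) _.
rewrite subSS subSS subn0 leq_mul2r; apply/orP; right.
by rewrite -[4%N]/(2 ^ 2)%N expnAC leq_exp2r.
Qed.

End Adversary.

End HiddenPairs.

Theorem theorem1p1 (R : realType) (V : finType) (n : nat) (cardV : #|V| = n)
    (ALG : algorithm R V) (ALG_correct : solves_SFM ALG) :
  exists F : {set V} -> R,
    submodular F /\
    exists (q : nat) (S : {set V}),
      [/\ runs ALG F [::] q S, minimizer F S
        & n%:R / 2 * log2 (n%:R / 4) <= q%:R :> R].
Proof.
have [qs [q [_ [S runS minS] leq]]] :
    exists qs q, [/\ completion [set: V] n./2 qs,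
      solves_from ALG (hidden R ([::] ++ qs)) [::] q & (#|[set: V]|`! <= 4 ^ q)%N].
  apply: adversary; first by rewrite cardsT cardV.
  move=> qs [disj _]; split=> //.
  by have [q [S [runS minS]]] := ALG_correct _ (hidden_submodular R qs); exists q, S.
exists (hidden R qs); split; first exact: hidden_submodular.
exists q, S; split=> //.
(* For n = 0 the factor n/2 vanishes, whatever the logarithm of 0 is. *)
have [->|n0] := posnP n; first by rewrite !mul0r.
rewrite cardsT cardV in leq.
(* Taking logarithms to base 2 gives n log n <= 2(n + q), that is, q >= (n/2)(log n - 2); the 2 is
   the logarithm of 4. *)
have le_pow : (n ^ n <= 2 ^ (2 * (n + q)))%N.
  apply: leq_trans (expnn_le_fact n) _.
  by rewrite expnM expnD leq_mul2l leq orbT.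
have n_pos : 0 < n%:R :> R by rewrite ltr0n.
have ln2_pos : 0 < ln 2 :> R by rewrite ln_gt0 // ltr1n.
have le_ln : n%:R * ln n%:R <= 2 * (n + q)%:R * ln 2 :> R.
  have : ln (n%:R ^+ n) <= ln (2 ^+ (2 * (n + q))) :> R.
    by rewrite ler_ln ?posrE ?exprn_gt0 // -!natrX ler_nat.
  by rewrite !lnXn // -!(mulr_natl (ln _)) natrM.
rewrite /log2 mulrA ler_pdivrMr // ln_div ?posrE //.
have -> : ln 4 = 2 * ln 2 :> R by rewrite -[4]/((2 ^ 2)%:R) natrX lnXn // mulr_natl.
by rewrite natrD in le_ln; lra.
Qed.
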